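(* Let $\boldsymbol{X}(t)$ be the random state at time $t$ of the deterministic controlled system $\dot{\boldsymbol{x}}=f(\boldsymbol{x},\boldsymbol{u})$, $\boldsymbol{x}\in\mathbb{R}^{n}$, $\boldsymbol{u}\in\mathbb{R}^{n_u}$, under a control policy $\Pi$ on $[t_0,t]$, with differentiable flow map $\varphi_t(\cdot\,;\Pi)$, and let $p(\cdot,t_0)$ and $p(\cdot,t)$ be the probability density functions of the state at times $t_0$ and $t$. Then for every moment function $f^{(m)}$, $$\int_{\mathbb{R}^n} f^{(m)}(\boldsymbol{x})\,p(\boldsymbol{x},t)\,\mathrm{d}\boldsymbol{x}=\int_{\mathbb{R}^n} f^{(m)}\big(\varphi_t(\boldsymbol{x}_0;\Pi)\big)\,p(\boldsymbol{x}_0,t_0)\,\mathrm{d}\boldsymbol{x}_0 .$$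
   Context: The flow map $\varphi_t(\cdot\,;\Pi)$ of the ordinary differential equation $\dot{\boldsymbol{x}}=f(\boldsymbol{x},\boldsymbol{u})$ is the differentiable mapping sending the initial state $\boldsymbol{x}_0$ at time $t_0$ to the state $\boldsymbol{x}(t)=\varphi_t(\boldsymbol{x}_0;\Pi)$ at time $t$ when the control policy $\Pi=\Pi_{[t_0,t]}$ is applied on $[t_0,t]$. Randomness enters only through the initial state: $\boldsymbol{X}(t)=\varphi_t(\boldsymbol{X}(t_0);\Pi)$. The density $p(\boldsymbol{x},t)$ of $\boldsymbol{X}(t)$ evolves according to the Liouville equation $\partial_t p(\boldsymbol{x},t)+\nabla\cdot\big(p(\boldsymbol{x},t)f(\boldsymbol{x},\boldsymbol{u})\big)=0$. Its characteristic solution (a known fact) is $p(\boldsymbol{x},t)=p(\boldsymbol{x}_0,t_0)\det(\Phi(t,t_0;\Pi))^{-1}$ for $\boldsymbol{x}=\varphi_t(\boldsymbol{x}_0;\Pi)$, where $\Phi(t,t_0;\Pi)=\partial\varphi_t(\boldsymbol{x}_0;\Pi)/\partial\boldsymbol{x}_0$ is the Jacobian of the flow map. A moment function $f^{(m)}$ is an arbitrary measurable function on $\mathbb{R}^n$ whose expectation $\mathbb{E}[f^{(m)}(\boldsymbol{X})]=\int_{\mathbb{R}^n} f^{(m)}(\boldsymbol{x})p(\boldsymbol{x})\,\mathrm{d}\boldsymbol{x}$ is a statistical moment of the random vector $\boldsymbol{X}$ with density $p$; the expectations considered are assumed to exist. (The letter $f$ without superscript is the vector field and is unrelated to $f^{(m)}$.)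 *)

(* Defs.v *)
From HB Require Import structures.
From mathcomp Require Import all_boot all_order all_algebra.
From mathcomp Require Import all_classical all_reals all_analysis.

Set Implicit Arguments.
Unset Strict Implicit.
Unset Printing Implicit Defensive.

Import Order.TTheory GRing.Theory Num.Theory.
Import numFieldNormedType.Exports.

Local Open Scope classical_set_scope.
Local Open Scope ring_scope.

(* The state space R^n is 'rV[R]_n, with the product Borel sigma-algebra:
   the one generated by the coordinate maps.  It is also the sigma-algebra
   generated by the open sets, R being second countable. *)
Definition measure_rV_display : measure_display -> measure_display.
Proof. exact. Qed.

Section measurable_rV.
Context (R : realType) (n : nat).

Let coor : 'I_n -> 'rV[R]_n -> R := fun i x => x ord0 i.

Let rV_set0 : g_sigma_preimage coor set0.
Proof. exact: sigma_algebra0. Qed.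

Let rV_setC A : g_sigma_preimage coor A -> g_sigma_preimage coor (~` A).
Proof. exact: sigma_algebraC. Qed.

Let rV_bigcup (F : _^nat) : (forall i, g_sigma_preimage coor (F i)) ->
  g_sigma_preimage coor (\bigcup_i (F i)).
Proof. exact: sigma_algebra_bigcup. Qed.

HB.instance Definition _ := @isMeasurable.Build
  (measure_rV_display default_measure_display)
  'rV[R]_n (g_sigma_preimage coor) rV_set0 rV_setC rV_bigcup.

End measurable_rV.

Lemma measurable_rV_coord (R : realType) n (i : 'I_n) :
  measurable_fun [set: 'rV[R]_n] (fun x : 'rV[R]_n => x ord0 i).
Proof.
move=> _ Y mY; rewrite setTI; apply: sub_sigma_algebra => /=.
rewrite -bigcup_seq/=; exists i => /=; first by rewrite mem_index_enum.
by exists Y => //; rewrite setTI.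
Qed.

Lemma measurable_fun_rVP (R : realType) d (T : measurableType d) n
    (f : T -> 'rV[R]_n) :
  (forall i, measurable_fun [set: T] (fun x => f x ord0 i)) ->
  measurable_fun [set: T] f.
Proof.
move=> mf _ A mA; rewrite setTI.
suff : g_sigma_preimage (fun i : 'I_n => (fun x : 'rV[R]_n => x ord0 i) \o f)
    `<=` measurable.
  by apply; rewrite g_sigma_preimage_comp; exists A => //; rewrite setTI.
apply: smallest_sub; first exact: sigma_algebra_measurable.
rewrite -bigcup_seq; apply: bigcup_sub => i _ _ [B mB <-].
exact: mf.
Qed.

Definition rV_cons (R : realType) n (vx : 'rV[R]_n * measurableTypeR R) :
    'rV[R]_n.+1 :=
  \row_i oapp (vx.1 ord0) vx.2 (unlift ord0 i).

Lemma measurable_rV_cons (R : realType) n :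
  measurable_fun [set: 'rV[R]_n * measurableTypeR R] (@rV_cons R n).
Proof.
apply: measurable_fun_rVP => i.
case: (unliftP ord0 i) => [j ->|->].
- rewrite (_ : (fun _ => _) = (fun v : 'rV[R]_n => v ord0 j) \o fst); last first.
    by apply/funext => vx; rewrite mxE liftK.
  exact: measurableT_comp (@measurable_rV_coord R n j) measurable_fst.
- rewrite (_ : (fun _ => _) = snd); first exact: measurable_snd.
  by apply/funext => vx; rewrite mxE unlift_none.
Qed.

(* Lebesgue measure on R^n as the n-fold product of the one-dimensional
   Lebesgue measure; on the one-point space R^0 it is the unit mass.  The canonical instance is written
   out because it carries the measurability proof of the map pushed along. *)
Fixpoint lebesgue_rV (R : realType) (n : nat) :
    {measure set 'rV[R]_n -> \bar R} :=
  match n with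
  | 0%N => @dirac _ 'rV[R]_0 0 R
  | n'.+1 =>
      measure_function_pushforward__canonical__measure_function_Measure
        (lebesgue_rV R n' \x @lebesgue_measure R)%E (@measurable_rV_cons R n')
  end.
Arguments lebesgue_rV {R} n.

Lemma lebesgue_rV_box (R : realType) n (a b : 'rV[R]_n) :
  (forall i, a ord0 i <= b ord0 i) ->
  lebesgue_rV n [set x | forall i, x ord0 i \in `[a ord0 i, b ord0 i]] =
  (\prod_(i < n) (b ord0 i - a ord0 i))%:E.
Proof.
elim: n a b => [|n IHn] a b ab.
  by rewrite big_ord0 /= diracE mem_set// => -[].
pose a' : 'rV[R]_n := \row_i a ord0 (lift ord0 i).
pose b' : 'rV[R]_n := \row_i b ord0 (lift ord0 i).
rewrite big_ord_recl mulrC EFinM /= /pushforward.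
have -> : @rV_cons R n @^-1` [set x | forall i, x ord0 i \in
      `[a ord0 i, b ord0 i]] =
    [set x : 'rV[R]_n | forall i, x ord0 i \in `[a' ord0 i, b' ord0 i]] `*`
    `[a ord0 ord0, b ord0 ord0]%classic.
  apply/seteqP; split => [[v x] /= h|[v x] /= [h1 h2] i].
    split=> [i|]; last by have := h ord0; rewrite mxE unlift_none.
    by have := h (lift ord0 i); rewrite !mxE liftK.
  rewrite mxE; case: (unliftP ord0 i) => [j ->|->] /=.
    by have := h1 j; rewrite !mxE.
  by [].
rewrite product_measure1E//; last first.
  rewrite (_ : mkset _ = \bigcap_(i in [set: 'I_n])
      ((fun x : 'rV[R]_n => x ord0 i) @^-1` `[a' ord0 i, b' ord0 i]%classic)).
    apply: fin_bigcap_measurable => // i _.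
    rewrite -[X in measurable X]setTI.
    by apply: measurable_rV_coord.
  by apply/seteqP; split => x /= h i; [move=> _|]; apply: h.
rewrite IHn; last by move=> i; rewrite !mxE.
congr (_ * _)%E.
  by congr EFin; apply: eq_bigr => i _; rewrite !mxE.
rewrite [LHS](lebesgue_measure_itv `[a ord0 ord0, b ord0 ord0])/= lte_fin.
by rewrite lt_neqAle ab andbT; case: eqP => //= ->; rewrite subrr.
Qed.

(* [Pi tau x] is the control input at time [tau] in state [x]; an open-loop
   policy is one that ignores [x].  The differential equation is required up to
   countably many switching times per trajectory, so that policies with jumps
   are covered. *)
Record is_flow_map (R : realType) (n nu : nat)
    (f : 'rV[R]_n -> 'rV[R]_nu -> 'rV[R]_n)
    (Pi : R -> 'rV[R]_n -> 'rV[R]_nu) (t0 t : R)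
    (phi : R -> 'rV[R]_n -> 'rV[R]_n) : Prop := IsFlowMap {
  flow_initial : forall x0, phi t0 x0 = x0;
  flow_continuous : forall x0, {within `[t0, t], continuous (phi ^~ x0)};
  flow_ode : forall x0, exists2 D : set R, countable D &
    forall tau, tau \in `]t0, t[ -> ~ D tau ->
      is_derive tau 1 (phi ^~ x0)
        (f (phi tau x0) (Pi tau (phi tau x0)));
  flow_differentiable : forall tau, tau \in `[t0, t] ->
    forall x0, differentiable (phi tau) x0 }.

Definition is_pdf (R : realType) (n : nat) d (T : measurableType d)
    (P : probability T R) (X : {RV P >-> 'rV[R]_n}) (p : 'rV[R]_n -> R) : Prop :=
  [/\ measurable_fun setT p, (forall x, 0 <= p x) &
      forall A, measurable A ->
        distribution P X A = (\int[lebesgue_rV n]_(x in A) (p x)%:E)%E].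

(* Main.v *)
Require Import Defs.
From HB Require Import structures.
From mathcomp Require Import all_boot all_order all_algebra.
From mathcomp Require Import all_classical all_reals all_analysis.
From mathcomp Require Import measurable_realfun.

Set Implicit Arguments.
Unset Strict Implicit.
Unset Printing Implicit Defensive.

Import Order.TTheory GRing.Theory Num.Theory.
Import numFieldNormedType.Exports.

Local Open Scope classical_set_scope.
Local Open Scope ring_scope.

(** Both sides are the same expectation over [Omega].  Integrating [g] against
    a density of a random vector [X] gives the expectation of [g (X w)]
    ([integral_pdf]); with [X t] and [fm] this turns the left-hand side into
    the expectation of [fm (X t w)], and with [X t0] and [fm \o phi t] the
    right-hand side into the expectation of [fm (phi t (X t0 w))].  The two
    integrands agree at every [w] because the state at time [t] is the image
    of the initial state under the flow map.  The two densities enter only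
    through the laws that they represent.

    Two points need work.  The function [fm \o phi t] must be measurable for
    the product sigma-algebra of R^n, which follows from the continuity of
    [phi t] once open sets are known to belong to it
    ([open_measurable_rV]).  And a measure given by a density on sets must be
    given by it on functions ([ge0_integral_density]). *)

Lemma measurable_rV_box (R : realType) n (a b : 'rV[R]_n) :
  measurable [set x : 'rV[R]_n | forall i, x ord0 i \in `]a ord0 i, b ord0 i[].
Proof.
rewrite (_ : mkset _ = \bigcap_(i in [set: 'I_n])
    ((fun x : 'rV[R]_n => x ord0 i) @^-1` `]a ord0 i, b ord0 i[%classic)).
  apply: fin_bigcap_measurable => // i _; rewrite -[X in measurable X]setTI.
  by apply: measurable_rV_coord.
by apply/seteqP; split => x /= h i; [move=> _|]; apply: h.
Qed.

(** Boxes with rational corners form a countable family, and every point of an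
    open set lies in one of them that is contained in the set, since balls of
    the sup norm are themselves boxes. *)
Lemma open_measurable_rV (R : realType) n (U : set 'rV[R]_n) :
  open U -> measurable U.
Proof.
move=> oU.
pose B (ab : 'rV[rat]_n * 'rV[rat]_n) := [set x : 'rV[R]_n | forall i,
  x ord0 i \in `]map_mx ratr ab.1 ord0 i, map_mx ratr ab.2 ord0 i[ ].
(* Boxes that leave [U] are replaced by the empty set, so that the union can
   range over all pairs of corners. *)
pose F ab := if ab \in [set ab | B ab `<=` U] then B ab else set0.
have -> : U = \bigcup_ab F ab.
  apply/seteqP; split=> [x Ux|x [ab _]]; last first.
    by rewrite /F; case: ifPn => // /set_mem /= BU; apply: BU.
  have /nbhs_ballP[e /= e0 xeU] := open_nbhs_nbhs (conj oU Ux).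
  (* Corners at distance less than [e] from [x] on either side confine the box
     to the ball of radius [e]. *)
  have /fin_all_exists[a xa] : forall i, exists q : rat,
      ratr q \in `]x ord0 i - e, x ord0 i[.
    by move=> i; apply: rat_in_itvoo; rewrite ltrBlDr ltrDl.
  have /fin_all_exists[b xb] : forall i, exists q : rat,
      ratr q \in `]x ord0 i, x ord0 i + e[.
    by move=> i; apply: rat_in_itvoo; rewrite ltrDl.
  exists (\row_i a i, \row_i b i) => //; rewrite /F mem_set.
    move=> i; rewrite !mxE in_itv /=.
    by have := xa i; have := xb i; rewrite !in_itv/= => /andP[-> _] /andP[_ ->].
  move=> y By; apply: xeU; split=> // j i.
  rewrite (ord1 j) /ball/= ltr_distlC.
  have := By i; rewrite !mxE !in_itv/= => /andP[ay yb].
  have := xa i; have := xb i; rewrite !in_itv/= => /andP[_ be] /andP[ea _].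
  by rewrite (lt_trans ea ay) (lt_trans yb be).
apply: countable_bigcupT_measurable => [|ab]; first exact: countableP.
by rewrite /F; case: ifP => // _; apply: measurable_rV_box.
Qed.

Lemma continuous_measurable_rV (R : realType) m n (g : 'rV[R]_m -> 'rV[R]_n) :
  continuous g -> measurable_fun [set: 'rV[R]_m] g.
Proof.
move=> /continuousP cg; apply: measurable_fun_rVP => i.
apply: (measurability _ (RGenOpens.measurableE R)) => _ [_ [a [b ->] <-]].
rewrite setTI; apply: open_measurable_rV.
apply: (cg ((fun y : 'rV[R]_n => y ord0 i) @^-1` `]a, b[%classic)).
have /continuousP cc := @coord_continuous R 1 n ord0 i.
exact/cc/interval_open.
Qed.

Section density.
Context d (T : measurableType d) (R : realType).
Variables (mu nu : {measure set T -> \bar R}) (p : T -> R).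
Hypotheses (mp : measurable_fun setT p) (p0 : forall x, 0 <= p x)
  (nuE : forall A, measurable A -> nu A = (\int[mu]_(x in A) (p x)%:E)%E).
Local Open Scope ereal_scope.

Import HBNNSimple.

(** By linearity it suffices to treat the indicators of the level sets of [h],
    for which the identity is the definition of a density. *)
Lemma integral_density_nnsfun (h : {nnsfun T >-> R}) :
  \int[nu]_x (h x)%:E = \int[mu]_x (h x * p x)%:E.
Proof.
rewrite integralT_nnsfun sintegralE.
transitivity (\int[mu]_x (\sum_(y \in range h)
    (y * (\1_(h @^-1` [set y]) x * p x))%:E)).
  rewrite ge0_integral_fsum//; last 2 first.
  - move=> y; apply/measurable_EFinP; apply: measurable_funM => //.
    exact: measurable_funM.
  - move=> y x _; rewrite mulrA EFinM mule_ge0 ?lee_fin//.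
    exact: nnfun_muleindic_ge0.
  apply: eq_fsbigr => y /set_mem[x _ <-].
  under eq_integral do rewrite EFinM.
  rewrite ge0_integralZl//; last 3 first.
  - by apply/measurable_EFinP; exact: measurable_funM.
  - by move=> z _; rewrite lee_fin mulr_ge0.
  - by rewrite lee_fin.
  rewrite nuE// -[in LHS](setTI (h @^-1` _)) integral_mkcondr.
  congr (_ * _); apply: eq_integral => z _.
  by rewrite epatch_indic EFinM muleC.
apply: eq_integral => x _; rewrite fsumEFin//; congr EFin.
rewrite [in RHS]fimfunE mulr_fsuml.
by apply: eq_fsbigr => y _; rewrite mulrA.
Qed.

(** Monotone convergence on both sides along simple functions increasing to
    [g]: multiplication by [p >= 0] preserves the monotonicity. *)
Lemma ge0_integral_density (g : T -> R) :
    measurable_fun setT g -> (forall x, (0 <= g x)%R) ->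
  \int[nu]_x (g x)%:E = \int[mu]_x (g x * p x)%:E.
Proof.
move=> mg g0.
have mEg : measurable_fun setT (EFin \o g) by exact/measurable_EFinP.
pose h := nnsfun_approx measurableT mEg.
have hg x : (h k x)%:E @[k --> \oo] --> (g x)%:E.
  by apply: (cvg_nnsfun_approx measurableT mEg) => // y _; rewrite lee_fin.
have hnd x k l : (k <= l)%N -> (h k x <= h l x)%R.
  by move=> kl; exact/lefP/nd_nnsfun_approx.
transitivity (limn (fun k => \int[nu]_x (h k x)%:E)).
  rewrite -monotone_convergence//.
  - by apply: eq_integral => x _; apply/esym/cvg_lim.
  - by move=> k; exact/measurable_EFinP.
  - by move=> k x _; rewrite lee_fin.
  - by move=> x _ k l kl; rewrite lee_fin hnd.
under eq_fun do rewrite integral_density_nnsfun.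
rewrite -monotone_convergence//.
- apply: eq_integral => x _; apply/cvg_lim => //.
  under eq_fun do rewrite EFinM.
  by rewrite EFinM; apply: cvgeZr.
- by move=> k; apply/measurable_EFinP; exact: measurable_funM.
- by move=> k x _; rewrite lee_fin mulr_ge0.
- by move=> x _ k l kl; rewrite lee_fin ler_wpM2r// hnd.
Qed.

End density.

(** Since [p >= 0], the positive and negative parts of [g * p] are those of [g]
    times [p], so the nonnegative case applies to each part;
    the integral is by definition the difference of the integrals of the two
    parts. *)
Lemma integral_pdf (R : realType) (n : nat) d (T : measurableType d)
    (P : probability T R) (X : {RV P >-> 'rV[R]_n}) (p : 'rV[R]_n -> R)
    (g : 'rV[R]_n -> R) :
    is_pdf X p -> measurable_fun setT g ->
  (\int[lebesgue_rV n]_x (g x * p x)%:E = \int[P]_w (g (X w))%:E)%E.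
Proof.
move=> [mp p0 pE] mg.
have ge0 (h : 'rV[R]_n -> R) : measurable_fun setT h -> (forall x, 0 <= h x) ->
    (\int[lebesgue_rV n]_x (h x * p x)%:E = \int[P]_w (h (X w))%:E)%E.
  move=> mh h0.
  rewrite -(@ge0_integral_density _ _ _ _ (distribution P X) _ mp p0 pE)//.
  rewrite (@ge0_integral_distribution _ _ _ _ _ _ X (EFin \o h))//.
  exact/measurable_EFinP.
pose gp x := g x * p x.
have gpE :
    (EFin \o gp)^\+%E = EFin \o (fun x => g^\+ x * p x).
  by rewrite funerpos; apply/funext => x /=; rewrite /funrpos maxr_pMl// mul0r.
have gnE :
    (EFin \o gp)^\-%E = EFin \o (fun x => g^\- x * p x).
  rewrite funerneg; apply/funext => x /=.
  by rewrite /funrneg maxr_pMl// mul0r mulNr.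
rewrite integralE [RHS]integralE.
rewrite [X in integral _ _ X]gpE.
rewrite [X in (_ - integral _ _ X)%E]gnE.
rewrite ge0; [|exact: measurable_funrpos|by move=> x; exact: funrpos_ge0].
rewrite ge0; [|exact: measurable_funrneg|by move=> x; exact: funrneg_ge0].
congr (_ - _)%E; apply: eq_integral => w _ /=.
  by rewrite funeposE /funrpos EFin_max.
by rewrite funenegE /funrneg EFin_max.
Qed.

Theorem lemma1 (R : realType) (n nu : nat)
    (f : 'rV[R]_n -> 'rV[R]_nu -> 'rV[R]_n)
    (Pi : R -> 'rV[R]_n -> 'rV[R]_nu) (t0 t : R) (t0_le_t : t0 <= t)
    (phi : R -> 'rV[R]_n -> 'rV[R]_n) (phi_flow : is_flow_map f Pi t0 t phi)
    (d : measure_display) (Omega : measurableType d) (P : probability Omega R)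
    (X : R -> {RV P >-> 'rV[R]_n})
    (X_flow : forall tau, tau \in `[t0, t] ->
      forall w, X tau w = phi tau (X t0 w))
    (p : 'rV[R]_n -> R -> R)
    (p_t0 : is_pdf (X t0) (p ^~ t0)) (p_t : is_pdf (X t) (p ^~ t))
    (fm : 'rV[R]_n -> R) (fm_meas : measurable_fun setT fm)
    (fm_int : (lebesgue_rV n).-integrable setT (fun x => (fm x * p x t)%:E)) :
  (\int[lebesgue_rV n]_x (fm x * p x t)%:E =
   \int[lebesgue_rV n]_x0 (fm (phi t x0) * p x0 t0)%:E)%E.
Proof.
have t_in : t \in `[t0, t] by rewrite in_itv /= lexx t0_le_t.
have m_phi : measurable_fun setT (phi t).
  apply: continuous_measurable_rV => x.
  exact/differentiable_continuous/(flow_differentiable phi_flow).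
rewrite (integral_pdf p_t fm_meas).
rewrite (integral_pdf p_t0 (measurableT_comp fm_meas m_phi)).
by apply: eq_integral => w _; rewrite X_flow.
Qed.
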